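(* Let $n=3$ and let $M$ be a Griffiths positive $2\times 2$ matrix of constant coefficient $(1,1)$-forms on $\mathbb{C}^3$. Let $\Omega=\det(M)$, a real $(2,2)$-form. Define a Hermitian form on $V^{1,0}$ by $Q(\alpha,\beta)=\sqrt{-1}\star(\alpha\wedge\overline{\beta}\wedge\Omega)$. Then $Q$ is positive definite on $V^{1,0}$.
   Context: $V^{p,q}$ is the space of constant coefficient $(p,q)$-forms on $\mathbb{C}^n$. A $(1,1)$-form is Kähler if it equals $\sum_l\frac{\sqrt{-1}}{2}dw_l\wedge d\overline{w_l}$ in some complex linear coordinates. A matrix $M=(\alpha_{i,j})$ of $(1,1)$-forms with $\alpha_{i,j}=\overline{\alpha_{j,i}}$ is Griffiths positive if $\sum_{i,j}\theta_i\alpha_{i,j}\overline{\theta_j}$ is Kähler for all nonzero $\theta$; $\det(M)=\alpha_{1,1}\wedge\alpha_{2,2}-\alpha_{1,2}\wedge\alpha_{2,1}$. $\star:V^{3,3}\to\mathbb{C}$ denotes the Hodge star on top-degree forms: $\eta=\star(\eta)\,\mathrm{Vol}$, where $\mathrm{Vol}=\bigwedge_{l=1}^3\frac{\sqrt{-1}}{2}dz_l\wedge d\overline{z_l}$ for fixed complex linear coordinates $(z_1,z_2,z_3)$ (the sign of $\star$ does not depend on this choice). *)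

(* Defs.v *)
(* Constant-coefficient complex differential forms on C^3,
   with coefficients in C := R[i] for R : realType (so C is the complex numbers). *)
From HB Require Import structures.
From mathcomp Require Import all_boot all_order all_algebra.
From mathcomp Require Import complex.
From mathcomp Require Import reals.
Set Implicit Arguments. Unset Strict Implicit. Unset Printing Implicit Defensive.
Import Order.TTheory GRing.Theory Num.Theory.
Local Open Scope ring_scope.
Local Open Scope complex_scope.

Section Forms.
Variable R : realType.
Local Notation C := (R[i]).

(* Basis 1-forms of C^3 (real dimension 6): index k : 'I_6 with
   k = 0,1,2 standing for dz_1,dz_2,dz_3 and k = 3,4,5 for dzbar_1,dzbar_2,dzbar_3.
   A constant-coefficient cform is its family of coefficients on the basis
   monomials e_S = e_{s_1} /\ ... /\ e_{s_r} (s_1 < ... < s_r), S : {set 'I_6}. *)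
Definition cform := {set 'I_6} -> C.

Definition holo (k : 'I_6) : bool := (k < 3)%N.

Definition fadd (a b : cform) : cform := fun S => a S + b S.
Definition fopp (a : cform) : cform := fun S => - a S.
Definition fscale (c : C) (a : cform) : cform := fun S => c * a S.
Definition fzero : cform := fun _ => 0.

(* sign of the shuffle bringing e_A /\ e_B to e_(A :|: B) *)
Definition shuffle_sign (A B : {set 'I_6}) : C :=
  (-1) ^+ #|[set p : 'I_6 * 'I_6 | (p.1 \in A) && (p.2 \in B) && (p.2 < p.1)%N]|.

Definition wedge (a b : cform) : cform := fun S =>
  \sum_(A : {set 'I_6} | A \subset S) shuffle_sign A (S :\: A) * a A * b (S :\: A).

(* basis 1-cform e_k *)
Definition gen (k : 'I_6) : cform := fun S => if S == [set k] then 1 else 0.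
Definition dz (l : 'I_3) : cform := gen (lshift 3 l).
Definition dzb (l : 'I_3) : cform := gen (rshift 3 l).

Definition fone : cform := fun S => if S == set0 then 1 else 0.

(* complex conjugation of basis generators: dz_l <-> dzbar_l *)
Definition swap6 (k : 'I_6) : 'I_6 :=
  match @split 3 3 k with inl l => rshift 3 l | inr l => lshift 3 l end.

(* ordered wedge of a list of forms *)
Definition bigwedge (s : seq cform) : cform := foldr wedge fone s.

(* complex conjugation: conj (sum c_S e_S) = sum conj(c_S) conj(e_{s_1}) /\ ... *)
Definition fconj (a : cform) : cform := fun T =>
  \sum_(S : {set 'I_6}) (a S)^* * bigwedge [seq gen (swap6 k) | k <- enum S] T.

(* a is of bidegree (p,q): supported on monomials with p holomorphic and
   q antiholomorphic factors *)
Definition is_pq (p q : nat) (a : cform) : Prop :=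
  forall S : {set 'I_6}, a S != 0 ->
    #|[set k in S | holo k]| = p /\ #|[set k in S | ~~ holo k]| = q.

(* the standard cform sum_l (sqrt(-1)/2) dw_l /\ conj(dw_l) in the linear
   coordinates w = P z, i.e. dw_l = sum_k P l k dz_k *)
Definition dw (P : 'M[C]_3) (l : 'I_3) : cform :=
  fun S => \sum_(k < 3) P l k * dz k S.

Definition std_kahler (P : 'M[C]_3) : cform :=
  fun S => \sum_(l < 3) fscale ('i / 2%:R) (wedge (dw P l) (fconj (dw P l))) S.

(* Kähler: equal to the standard cform in some complex linear coordinates *)
Definition kahler (a : cform) : Prop :=
  is_pq 1 1 a /\ exists P : 'M[C]_3, P \in unitmx /\ a = std_kahler P.

(* Griffiths positivity of a 2x2 matrix of (1,1)-forms *)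
Definition griffiths_positive (M : 'I_2 -> 'I_2 -> cform) : Prop :=
  (forall i j, is_pq 1 1 (M i j)) /\
  (forall i j, M i j = fconj (M j i)) /\
  (forall theta : 'I_2 -> C, (exists i, theta i != 0) ->
     kahler (fun S => \sum_(i < 2) \sum_(j < 2) theta i * M i j S * (theta j)^*)).

Definition det2 (M : 'I_2 -> 'I_2 -> cform) : cform :=
  fadd (wedge (M 0 0) (M 1 1)) (fopp (wedge (M 0 1) (M 1 0))).

(* Vol = /\_l (sqrt(-1)/2) dz_l /\ dzbar_l *)
Definition Vol : cform :=
  bigwedge [seq fscale ('i / 2%:R) (wedge (dz l) (dzb l)) | l <- enum 'I_3].

(* Hodge star on top-degree forms: eta = star eta * Vol *)
Definition star (eta : cform) : C := eta setT / Vol setT.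

Definition Qform (Om : cform) (a b : cform) : C :=
  'i * star (wedge (wedge a (fconj b)) Om).

End Forms.

(* Main.v *)
Require Import Defs.
From HB Require Import structures.
From mathcomp Require Import all_boot all_order all_algebra.
From mathcomp Require Import complex.
From mathcomp Require Import boolp reals.
From mathcomp Require Import ring.
Set Implicit Arguments. Unset Strict Implicit. Unset Printing Implicit Defensive.
Import Order.TTheory GRing.Theory Num.Theory.
Local Open Scope ring_scope.

(* In the coordinates z, write M_ij = sqrt(-1)/2 sum_kl A_ij(k,l) dz_k /\ dzbar_l. Then Q(a,a) is twice
   D(A_00, A_11; a) - D(A_01, A_10; a), with D a mixed discriminant. If a is proportional to the cross product
   v x w, then D(A, B; a) is proportional to the mixed discriminant of the restrictions of A and B to
   span(v, w). The main point is the choice of v and w orthogonal for both A_00 and A_11. With x, y, p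
   the values of A_00, A_11, A_01 on v and x', y', s those on w, Griffiths positivity on the two
   vectors v and w gives |p|^2 < x y and |s|^2 < x' y', and by AM-GM
   2 Re (p conj(s)) < x y' + x' y. The remaining terms |A_01(v,w)|^2 and |A_01(w,v)|^2 enter with
   the favorable sign. *)

Lemma sum2E (V : nmodType) (F : 'I_2 -> V) : \sum_(i < 2) F i = F 0 + F 1.
Proof. by rewrite !big_ord_recl big_ord0 addr0; congr (_ + F _); apply: val_inj. Qed.

Lemma sum3E (V : nmodType) (F : 'I_3 -> V) :
  \sum_(i < 3) F i = F 0 + F 1 + F 2.
Proof.
rewrite !big_ord_recl big_ord0 addr0 addrA.
by congr (_ + F _ + F _); apply: val_inj.
Qed.

(** * Two sesquilinear forms on a plane, and the scalar inequality *)

Section HermitianPencil.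
Variable C : numClosedFieldType.
Implicit Types (A B : 'M[C]_2) (x y : 'rV[C]_2).

Definition herm_form B x y : C := (x *m B *m (map_mx Num.conj y)^T) 0 0.

Lemma herm_formE B x y :
  herm_form B x y = \sum_(i < 2) \sum_(j < 2) B i j * x 0 i * (y 0 j)^*.
Proof.
rewrite /herm_form mxE exchange_big; apply: eq_bigr => j _.
rewrite !mxE mulr_suml; apply: eq_bigr => i _.
by rewrite (mulrC (x 0 i)).
Qed.

(* A basis orthogonal for both forms: [x] is an eigenvector of [A *m invmx B] and [y] spans the
   [B]-orthogonal of [x]. *)
Lemma pencil_orthogonal_basis A B :
    (forall x, x != 0 -> 0 < herm_form B x x) ->
  exists x y, [/\ x 0 0 * y 0 1 - x 0 1 * y 0 0 != 0,
    herm_form A x y = 0 & herm_form B x y = 0].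
Proof.
move=> Bpos.
have Bunit : B \in unitmx.
  rewrite -row_free_unit -kermx_eq0; apply/negPn/negP => /rowV0Pn[x /sub_kermxP xB x0].
  by have := Bpos x x0; rewrite /herm_form xB mul0mx mxE ltxx.
have [a /eigenvalueP[x xAB x0]] := eigenvalue_closed (A *m invmx B) isT.
have xA : x *m A = a *: (x *m B) by rewrite scalemxAl -xAB mulmxA mulmxKV.
pose z := x *m B.
(* In dimension two the vectors orthogonal to [x] form a line: [y] is the conjugate of [z = x *m B]
   turned by a quarter turn. *)
pose y : 'rV[C]_2 := \row_j (if j == 0 then (z 0 1)^* else - (z 0 0)^*).
have zy : (z *m (map_mx Num.conj y)^T) 0 0 = 0.
  by rewrite mxE sum2E !mxE /= rmorphN /= !conjCK; ring.
exists x, y; split; last by [].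
  have := Bpos x x0; rewrite /herm_form -/z mxE sum2E !mxE /= => xBx.
  (* By the choice of [y], the determinant of the pair [x], [y] is minus the conjugate of
     [herm_form B x x]. *)
  have := lt0r_neq0 xBx; rewrite -conjC_eq0 rmorphD !rmorphM /= !conjCK => h.
  by move: h; rewrite -oppr_eq0; congr (~~ (_ == _)); ring.
(* As [x *m A] is a multiple of [x *m B], orthogonality for [B] passes to [A]. *)
by rewrite /herm_form xA -scalemxAl mxE zy mulr0.
Qed.

Lemma norm_lt_of_form_gt0 (x y p : C) :
    (forall s t : C, (s != 0) || (t != 0) ->
       0 < x * s * s^* + p * s * t^* + p^* * t * s^* + y * t * t^*) ->
  [/\ 0 < x, 0 < y & p * p^* < x * y].
Proof.
move=> H.
have x0 : 0 < x.
  by have := H 1 0; rewrite oner_eq0 /= rmorph1 rmorph0 !(mulr0, mulr1, addr0); apply.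
have y0 : 0 < y.
  by have := H 0 1; rewrite oner_eq0 orbT /= rmorph1 rmorph0 !(mulr0, mulr1, add0r); apply.
split=> //.
have yc : y^* = y by apply: conj_Creal; rewrite gtr0_real.
(* Completing the square: for [s = y] the form is least at [t = - p], where its value is [y] times
   the determinant. *)
have := H y (- p); rewrite (gt_eqF y0) rmorphN /= yc => /(_ isT).
rewrite [X in 0 < X](_ : _ = y * (x * y - p * p^*)); last by ring.
by rewrite (pmulr_rgt0 _ y0) subr_gt0.
Qed.

(** AM-GM without square roots: [y1 * y2] times the difference of the two sides is the sum of the
    two positive determinants, with weights [y2 ^+ 2] and [y1 ^+ 2], and of the squared modulus of
    [y2 * p - y1 * s]. *)
Lemma mixed_det_ineq (x1 y1 p x2 y2 s : C) :
    0 < x1 -> 0 < y1 -> p * p^* < x1 * y1 ->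
    0 < x2 -> 0 < y2 -> s * s^* < x2 * y2 ->
  p * s^* + s * p^* < x1 * y2 + x2 * y1.
Proof.
move=> x10 y10 hp x20 y20 hs.
have y1c : y1^* = y1 by apply: conj_Creal; rewrite gtr0_real.
have y2c : y2^* = y2 by apply: conj_Creal; rewrite gtr0_real.
have := mul_conjC_ge0 (y2 * p - y1 * s).
rewrite rmorphB !rmorphM /= y1c y2c => h.
have yy : 0 < y1 * y2 by rewrite mulr_gt0.
rewrite -subr_gt0 -(pmulr_rgt0 _ yy).
have h1 : 0 < y2 ^+ 2 * (x1 * y1 - p * p^*) by rewrite mulr_gt0 ?exprn_gt0 ?subr_gt0.
have h2 : 0 < y1 ^+ 2 * (x2 * y2 - s * s^*) by rewrite mulr_gt0 ?exprn_gt0 ?subr_gt0.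
rewrite [X in 0 < X](_ : _ = y2 ^+ 2 * (x1 * y1 - p * p^*) + y1 ^+ 2 * (x2 * y2 - s * s^*)
  + (y2 * p - y1 * s) * (y2 * p^* - y1 * s^*)); last by ring.
by rewrite ltr_wpDr // addr_gt0.
Qed.

End HermitianPencil.

(** * Mixed discriminants in dimension three and the positivity argument *)

Section MixedDiscriminant.
Variable C : numClosedFieldType.
Implicit Types (A B : 'I_3 -> 'I_3 -> C) (v w : 'I_3 -> C).

Definition sesq A v w : C :=
  \sum_(k < 3) \sum_(l < 3) A k l * v k * (w l)^*.

(** The bracket polarizes the cofactor: for [A = B] it is twice the cofactor at [(k, l)]. Indices
    are taken modulo 3, which absorbs the checkerboard signs. With the normalization D(A,A,A) = det
    A, this is six times the mixed discriminant of [A], [B] and the rank-one matrix with entries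
    [a k * (a l)^*]. *)
Definition mixed_disc A B (a : 'I_3 -> C) : C :=
  \sum_(k < 3) \sum_(l < 3) a k * (a l)^* *
    (A (k + 1) (l + 1) * B (k + 2) (l + 2) - A (k + 1) (l + 2) * B (k + 2) (l + 1)
     - A (k + 2) (l + 1) * B (k + 1) (l + 2) + A (k + 2) (l + 2) * B (k + 1) (l + 1)).

Definition cross v w (k : 'I_3) : C :=
  v (k + 1) * w (k + 2) - v (k + 2) * w (k + 1).

Lemma ord3_cyclic : (((0 + 1)%R = 1 :> 'I_3) * ((0 + 2)%R = 2 :> 'I_3) * ((1 + 1)%R = 2 :> 'I_3)
  * ((1 + 2)%R = 0 :> 'I_3) * ((2 + 1)%R = 0 :> 'I_3) * ((2 + 2)%R = 1 :> 'I_3))%type.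
Proof. by do !split; apply: val_inj. Qed.

(** Polarized Cauchy-Binet: for [A = B] both sides are twice the determinant of the restriction of
    [A] to the pair [v], [w]. *)
Lemma mixed_disc_cross A B v w :
  mixed_disc A B (cross v w) =
    sesq A v v * sesq B w w + sesq A w w * sesq B v v
    - sesq A v w * sesq B w v - sesq A w v * sesq B v w.
Proof.
rewrite /mixed_disc /sesq /cross !sum3E !ord3_cyclic !rmorphB !rmorphM /=.
move: (v 0) (v 1) (v 2) (w 0) (w 1) (w 2) => v0 v1 v2 w0 w1 w2.
(* With the conjugates as independent variables, the claim is a polynomial identity. *)
move: v0^* v1^* v2^* w0^* w1^* w2^* => v0' v1' v2' w0' w1' w2'.
move: (A 0 0) (A 0 1) (A 0 2) (A 1 0) (A 1 1) (A 1 2) (A 2 0) (A 2 1) (A 2 2).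
move: (B 0 0) (B 0 1) (B 0 2) (B 1 0) (B 1 1) (B 1 2) (B 2 0) (B 2 1) (B 2 2).
move=> *; ring.
Qed.

Lemma mixed_disc_scale A B c (a b : 'I_3 -> C) : (forall k, b k = c * a k) ->
  mixed_disc A B b = c * c^* * mixed_disc A B a.
Proof.
move=> bE; rewrite /mixed_disc mulr_sumr; apply: eq_bigr => k _.
rewrite mulr_sumr; apply: eq_bigr => l _; rewrite !bE rmorphM /=.
set z := (_ + _ : C); ring.
Qed.

Lemma ord3P (P : 'I_3 -> Prop) : P 0 -> P 1 -> P 2 -> forall k, P k.
Proof.
move=> P0 P1 P2 [[|[|[|//]]] ?].
- by move: P0; congr P; apply: val_inj.
- by move: P1; congr P; apply: val_inj.
- by move: P2; congr P; apply: val_inj.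
Qed.

Lemma exists_cross (a : 'I_3 -> C) : (exists k, a k != 0) ->
  exists v w c, c != 0 /\ forall k, cross v w k = c * a k.
Proof.
(* The two vectors span the kernel of the functional with coefficients [a], solved for the
   coordinate [m] where [a] does not vanish. Their cross product is [a m] times [a]. *)
case=> m am; exists (fun k => if k == m + 1 then a m else if k == m then - a (m + 1) else 0).
exists (fun k => if k == m + 2 then a m else if k == m then - a (m + 2) else 0), (a m).
split=> // {am}; move: m; apply: ord3P; apply: ord3P; rewrite /cross !ord3_cyclic /=; ring.
Qed.

Lemma cross_lin (x y : 'rV[C]_2) v w k :
  cross (fun k => x 0 0 * v k + x 0 1 * w k) (fun k => y 0 0 * v k + y 0 1 * w k) k
  = (x 0 0 * y 0 1 - x 0 1 * y 0 0) * cross v w k.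
Proof. by rewrite /cross; ring. Qed.

Lemma herm_form_sesq A v w (x y : 'rV[C]_2) :
  herm_form (\matrix_(i, j) sesq A (if i == 0 then v else w) (if j == 0 then v else w)) x y
  = sesq A (fun k => x 0 0 * v k + x 0 1 * w k) (fun k => y 0 0 * v k + y 0 1 * w k).
Proof.
rewrite herm_formE !sum2E !mxE /= /sesq !sum3E !rmorphD !rmorphM /=.
ring.
Qed.

Lemma sesq_conj A B v w : (forall k l, A k l = (B l k)^*) -> sesq A v w = (sesq B w v)^*.
Proof.
move=> AB; rewrite /sesq exchange_big rmorph_sum; apply: eq_bigr => k _ /=.
rewrite rmorph_sum; apply: eq_bigr => l _ /=.
by rewrite !rmorphM /= conjCK AB mulrAC.
Qed.

Lemma eq_sesq A B v w : (forall k l, A k l = B k l) -> sesq A v w = sesq B v w.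
Proof. by move=> AB; do 2 (apply: eq_bigr => ? _); rewrite AB. Qed.

Lemma sesq_sum (A : 'I_2 -> 'I_2 -> 'I_3 -> 'I_3 -> C) (s t : 'I_2 -> C) v w :
  \sum_(i < 2) \sum_(j < 2) s i * sesq (A i j) v w * t j =
  sesq (fun k l => \sum_(i < 2) \sum_(j < 2) s i * A i j k l * t j) v w.
Proof. by rewrite !sum2E /sesq !sum3E !sum2E; ring. Qed.

(** The value is the squared norm of [P] applied to [v], which is nonzero because [P] is
    invertible. *)
Lemma sesq_gram_gt0 (P : 'M[C]_3) v : P \in unitmx -> (exists k, v k != 0) ->
  0 < sesq (fun k l => \sum_(m < 3) P m k * (P m l)^*) v v.
Proof.
move=> Pu v0; pose w m := \sum_(k < 3) P m k * v k.
have -> : sesq (fun k l => \sum_(m < 3) P m k * (P m l)^*) v v = \sum_(m < 3) w m * (w m)^*.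
  rewrite /sesq /w !sum3E !rmorphD !rmorphM /=. ring.
have [m wm] : exists m, w m != 0.
  apply/existsP; apply: contraT; rewrite negb_exists => /forallP w0.
  have [k vk] := v0; case/negP: vk.
  have /(congr1 (mulmx (invmx P))) : P *m (\col_k v k) = 0.
    apply/colP => m; rewrite !mxE -[RHS](eqP (negbNE (w0 m))).
    by apply: eq_bigr => l _; rewrite mxE.
  by rewrite mulKmx // mulmx0 => /colP/(_ k); rewrite !mxE => ->.
rewrite (bigD1 m) //= ltr_pwDl ?mul_conjC_gt0 // sumr_ge0 // => *.
exact: mul_conjC_ge0.
Qed.

Lemma cross_neq0 v w k : cross v w k != 0 ->
  (exists k, v k != 0) /\ (exists k, w k != 0).
Proof.
move=> vwk; split; apply/existsP; apply: contraNT vwk; rewrite negb_exists => /forallP v0.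
  by rewrite /cross !(eqP (negbNE (v0 _))) !mul0r subrr.
by rewrite /cross !(eqP (negbNE (v0 _))) !mulr0 subrr.
Qed.

Lemma griffiths_mixed_disc_gt0 (A : 'I_2 -> 'I_2 -> 'I_3 -> 'I_3 -> C) (a : 'I_3 -> C) :
    (forall i j k l, A i j k l = (A j i l k)^*) ->
    (forall theta : 'I_2 -> C, (exists i, theta i != 0) ->
     forall v, (exists k, v k != 0) ->
       0 < \sum_(i < 2) \sum_(j < 2) theta i * sesq (A i j) v v * (theta j)^*) ->
    (exists k, a k != 0) ->
  0 < mixed_disc (A 0 0) (A 1 1) a - mixed_disc (A 0 1) (A 1 0) a.
Proof.
move=> Aherm Apos a0.
have sesqC i j v w : sesq (A i j) v w = (sesq (A j i) w v)^*.
  by apply: sesq_conj => k l; apply: Aherm.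
(* At a fixed [v], Griffiths positivity for [theta = (s, t)] says that the 2x2 scalar matrix of the
   values [sesq (A i j) v v] is positive definite. *)
have key v : (exists k, v k != 0) -> [/\ 0 < sesq (A 0 0) v v, 0 < sesq (A 1 1) v v
    & sesq (A 0 1) v v * (sesq (A 0 1) v v)^* < sesq (A 0 0) v v * sesq (A 1 1) v v].
  move=> v0; apply: norm_lt_of_form_gt0 => s t st.
  have th0 : exists i : 'I_2, (if i == 0 then s else t) != 0.
    by case/orP: st => ?; [exists 0 | exists 1].
  have := Apos _ th0 v v0; rewrite !sum2E /= -(sesqC 1 0).
  by congr (0 < _); ring.
have [u1 [u2 [c [c0 uE]]]] := exists_cross a0.
(* The restrictions of A_00 and A_11 to the plane spanned by [u1] and [u2], to which the pencil
   lemma applies. *)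
pose gram i := \matrix_(k < 2, l < 2)
  sesq (A i i) (if k == 0 then u1 else u2) (if l == 0 then u1 else u2).
have a0' : exists k, cross u1 u2 k != 0.
  by case: a0 => k ak; exists k; rewrite uE mulf_neq0.
pose comb (x : 'rV[C]_2) k := x 0 0 * u1 k + x 0 1 * u2 k.
(* Independence of [u1] and [u2]: crossing the combination with [u2], or with [u1] if the first
   coordinate is zero, gives a nonzero multiple of their cross product. *)
have comb0 x : x != 0 -> exists k, comb x k != 0.
  move=> x0; have [k uk] := a0'.
  have [x00|x00] := eqVneq (x 0 0) 0; last first.
    pose y : 'rV[C]_2 := \row_j (j == 1)%:R.
    have : cross (comb x) (comb y) k != 0.
      by rewrite cross_lin !mxE /= mulr1 mulr0 subr0 mulf_neq0.
    by case/cross_neq0.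
  have x01 : x 0 1 != 0.
    apply: contraNneq x0 => x01; apply/eqP/rowP => -[[|[|//]] j]; rewrite mxE.
      by rewrite -[RHS]x00; congr (x _ _); apply: val_inj.
    by rewrite -[RHS]x01; congr (x _ _); apply: val_inj.
  pose y : 'rV[C]_2 := \row_j (j == 0)%:R.
  have : cross (comb x) (comb y) k != 0.
    by rewrite cross_lin !mxE /= x00 mul0r mulr1 sub0r mulNr oppr_eq0 mulf_neq0.
  by case/cross_neq0.
have gram1 x : x != 0 -> 0 < herm_form (gram 1) x x.
  by move=> /comb0/key[_ + _]; rewrite herm_form_sesq.
have [x [y [d0]]] := pencil_orthogonal_basis (gram 0) gram1.
rewrite !herm_form_sesq -/(comb x) -/(comb y) => xy0 xy1.
set v := comb x in xy0 xy1; set w := comb y in xy0 xy1.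
pose d := (x 0 0 * y 0 1 - x 0 1 * y 0 0) * c.
(* Passing to the orthogonal basis of the plane only rescales the cross product, so it is still
   proportional to [a]. *)
have dE k : cross v w k = d * a k by rewrite cross_lin uE mulrA.
have dn0 : d != 0 by rewrite mulf_neq0.
have [v0 w0] : (exists k, v k != 0) /\ (exists k, w k != 0).
  by have [k ak] := a0; apply: (@cross_neq0 _ _ k); rewrite dE mulf_neq0.
have [av bv pv] := key v v0; have [aw bw pw] := key w w0.
have ineq := mixed_det_ineq av bv pv aw bw pw.
rewrite -(pmulr_rgt0 _ (_ : 0 < d * d^*)); last by rewrite mul_conjC_gt0.
rewrite mulrBr -!(mixed_disc_scale _ _ dE) !mixed_disc_cross.
(* Hermitian symmetry turns orthogonality of [v] to [w] into orthogonality of [w] to [v], which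
   removes all mixed terms of A_00 and A_11. It also expresses A_10 through A_01. *)
rewrite (sesqC 0 0 w v) (sesqC 1 1 w v) (sesqC 1 0 v v) (sesqC 1 0 w w).
rewrite (sesqC 1 0 v w) (sesqC 1 0 w v) xy0 xy1 ?rmorph0.
(* These are the off-diagonal values A_01(v,w) and A_01(w,v). The sum of their squared moduli is
   exactly the excess over [ineq]. *)
set p := sesq _ v w; set q := sesq (A 0 1) w v.
have pq : 0 <= p * p^* + q * q^* by rewrite addr_ge0 ?mul_conjC_ge0.
rewrite -subr_gt0 in ineq; apply: (lt_le_trans ineq); rewrite -subr_ge0.
move: pq; congr (0 <= _); ring.
Qed.
End MixedDiscriminant.

(** * Index sets of the monomials dz_k /\ dzbar_l *)

Definition pairset (k l : 'I_3) : {set 'I_6} := [set lshift 3 k; rshift 3 l].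

Lemma ord6P (P : 'I_6 -> Prop) :
  (forall k : 'I_3, P (lshift 3 k)) -> (forall k : 'I_3, P (rshift 3 k)) -> forall i, P i.
Proof. by move=> Pl Pr i; case: (split_ordP (i : 'I_(3 + 3))) => k ->. Qed.

Implicit Types k l m p q : 'I_3.

Lemma lshift_pairset m k l : (lshift 3 m \in pairset k l) = (m == k).
Proof. by rewrite !inE eq_lshift eq_lrshift orbF. Qed.

Lemma rshift_pairset m k l : (rshift 3 m \in pairset k l) = (m == l).
Proof. by rewrite !inE eq_rshift eq_rlshift. Qed.

Lemma lshift_set1l m k : (lshift 3 m \in [set lshift 3 k]) = (m == k).
Proof. by rewrite !inE eq_lshift. Qed.

Lemma lshift_set1r m k : (lshift 3 m \in [set rshift 3 k]) = false.
Proof. by rewrite !inE eq_lrshift. Qed.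

Lemma rshift_set1l m k : (rshift 3 m \in [set lshift 3 k]) = false.
Proof. by rewrite !inE eq_rlshift. Qed.

Lemma rshift_set1r m k : (rshift 3 m \in [set rshift 3 k]) = (m == k).
Proof. by rewrite !inE eq_rshift. Qed.

Definition in_shift :=
  (lshift_pairset, rshift_pairset, lshift_set1l, lshift_set1r, rshift_set1l, rshift_set1r).

Lemma set1l_inj : injective (fun k => [set lshift 3 k] : {set 'I_6}).
Proof. by move=> k m E; apply/eqP; rewrite -lshift_set1l -E set11. Qed.

Lemma set1r_inj : injective (fun k => [set rshift 3 k] : {set 'I_6}).
Proof. by move=> k m E; apply/eqP; rewrite -rshift_set1r -E set11. Qed.

Lemma holo_lshift k : holo (lshift 3 k).
Proof. by rewrite /holo /=. Qed.

Lemma holo_rshift k : holo (rshift 3 k) = false.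
Proof. by rewrite /holo /= ltnNge leq_addr. Qed.

Lemma pairset_inj k l k' l' : pairset k l = pairset k' l' -> k = k' /\ l = l'.
Proof.
move/setP => E; split; apply/eqP.
  by rewrite -(lshift_pairset _ k' l') -E in_shift.
by rewrite -(rshift_pairset _ k' l') -E in_shift.
Qed.

Lemma enum_pairset k l : enum (pairset k l) = [:: lshift 3 k; rshift 3 l].
Proof.
apply: (inj_map val_inj).
(* On natural numbers the enumeration is a filter of a concrete list, and the nine cases hold by
   computation. *)
have -> : map val (enum (pairset k l)) =
    [seq i <- iota 0 6 | (i == k :> nat) || (i == 3 + l)%N].
  rewrite -val_enum_ord filter_map; congr map.
  rewrite [LHS]/enum_mem -enumT; apply: eq_filter => i.
  by rewrite !inE -!val_eqE.
by move: k l; do 2 apply: ord3P.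
Qed.

Lemma setC_pairset k l :
  ~: pairset k l = pairset (k + 1) (l + 1) :|: pairset (k + 2) (l + 2).
Proof.
apply/setP; apply: ord6P => m; rewrite in_setC in_setU !in_shift.
  by move: m k; do 2 apply: ord3P.
by move: m l; do 2 apply: ord3P.
Qed.

Lemma disjoint_pairset k l k' l' :
  [disjoint pairset k l & pairset k' l'] = (k != k') && (l != l').
Proof.
apply/pred0P/andP => [E | [kk ll]].
  have := E (lshift 3 k); have := E (rshift 3 l).
  by rewrite /= !in_shift !eqxx /= => -> ->.
apply: ord6P => m; rewrite /= !in_shift.
  by case: eqP => // ->; apply: negbTE.
by case: eqP => // ->; apply: negbTE.
Qed.

Lemma setCD_pairset k l p q p' q' :
    uniq [:: k; p; p'] -> uniq [:: l; q; q'] ->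
  ~: pairset k l :\: pairset p q = pairset p' q'.
Proof.
move=> U V; apply/setP; apply: ord6P => m; rewrite in_setD in_setC !in_shift.
  by move: m k p p' U; do 4 apply: ord3P.
by move: m l q q' V; do 4 apply: ord3P.
Qed.

Section BigPairset.
Variables (T : Type) (idx : T).

Lemma big_pairset (op : Monoid.com_law idx) (F : 'I_6 -> T) k l :
  \big[op/idx]_(i in pairset k l) F i = op (F (lshift 3 k)) (F (rshift 3 l)).
Proof.
rewrite /pairset big_setU1 ?big_set1 //.
by rewrite in_shift.
Qed.

Lemma big_setC_pairset (op : Monoid.com_law idx) (F : 'I_6 -> T) k l :
  \big[op/idx]_(i in ~: pairset k l) F i =
  op (op (F (lshift 3 (k + 1))) (F (rshift 3 (l + 1))))
     (op (F (lshift 3 (k + 2))) (F (rshift 3 (l + 2)))).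
Proof.
rewrite setC_pairset -!big_pairset -bigU //=.
  by apply: eq_bigl => i; rewrite inE.
rewrite disjoint_pairset.
by move: k l; do 2 apply: ord3P.
Qed.
End BigPairset.

(** * Coefficients of wedge products, of conjugates and of the volume form *)

Section WedgeCoefficients.
Variable R : realType.
Local Notation C := (R[i]).
Implicit Types (a b X Y Z : cform R) (S A B : {set 'I_6}).

Lemma is_pq11_pairset a S : is_pq 1 1 a -> a S != 0 -> exists k l, S = pairset k l.
Proof.
move=> + aS => /(_ S aS)[/eqP/cards1P[x xE] /eqP/cards1P[y yE]].
have: x \in [set x] by rewrite set11.
have: y \in [set y] by rewrite set11.
rewrite -{1}xE -{1}yE !inE => /andP[yS yh] /andP[xS xh].
have SE i : i \in S = (i == x) || (i == y).
  apply/idP/orP => [iS | [/eqP-> | /eqP->] //].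
  case h: (holo i); [left | right].
    by rewrite -in_set1 -xE inE iS h.
  by rewrite -in_set1 -yE inE iS h.
move: x xh y yh SE {xE yE xS yS}.
apply: ord6P => [k _ | k]; last by rewrite holo_rshift.
apply: ord6P => [l | l _ SE]; first by rewrite holo_lshift.
by exists k, l; apply/setP => i; rewrite SE !inE.
Qed.

Lemma is_pq10_set1 a S : is_pq 1 0 a -> a S != 0 -> exists k, S = [set lshift 3 k].
Proof.
move=> + aS => /(_ S aS)[/eqP/cards1P[x xE] /eqP].
rewrite cards_eq0 => /eqP/setP yE.
have: x \in [set x] by rewrite set11.
rewrite -{1}xE !inE => /andP[xS xh].
have SE i : i \in S = (i == x).
  apply/idP/eqP => [iS | -> //].
  have := yE i; rewrite !inE iS /= => /negbFE h.
  by apply/eqP; rewrite -in_set1 -xE inE iS h.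
move: x xh SE {xE xS}; apply: ord6P => [k _ SE | k]; last by rewrite holo_rshift.
by exists k; apply/setP => i; rewrite SE !inE.
Qed.

Lemma is_pq_wedge (p q r s : nat) a b :
  is_pq p q a -> is_pq r s b -> is_pq (p + r) (q + s) (wedge a b).
Proof.
move=> ha hb S abS.
have [A /andP[AS]] : exists A, (A \subset S) && (shuffle_sign R A (S :\: A) * a A * b (S :\: A) != 0).
  apply/existsP; apply: contraNT abS; rewrite negb_exists => /forallP z.
  rewrite /wedge big1 // => A AS; apply/eqP.
  by have := z A; rewrite AS /= negbK.
rewrite !mulf_eq0 !negb_or => /andP[/andP[_ /ha[<- <-]] /hb[<- <-]].
have card_split (P : pred 'I_6) :
    #|[set k in S | P k]| = (#|[set k in A | P k]| + #|[set k in S :\: A | P k]|)%N.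
  rewrite -cardsUI [X in (_ = _ + X)%N](_ : _ = 0%N) ?addn0; last first.
    by apply/eqP; rewrite cards_eq0; apply/eqP/setP => i; rewrite !inE; case: (i \in A); rewrite ?andbF.
  apply: eq_card => i; rewrite !inE; case iA: (i \in A) => //=.
  by rewrite (subsetP AS) // orbF.
by split; rewrite card_split.
Qed.

(** In product form the sign can be evaluated one index at a time. *)
Lemma shuffle_signE A B :
  shuffle_sign R A B = \prod_(i in A) \prod_(j in B) (-1) ^+ (j < i)%N.
Proof.
rewrite /shuffle_sign -sum1dep_card pair_big /= (big_morph _ (exprD (-1 : C)) (expr0 _)).
rewrite [RHS]big_mkcond [LHS]big_mkcond /=. apply: eq_bigr => i _.
by case: (i.1 \in A); case: (i.2 \in B) => //=; case: (i.2 < i.1)%N.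
Qed.

Lemma shuffle_sign_set1 (i j : 'I_6) : shuffle_sign R [set i] [set j] = (-1) ^+ (j < i)%N.
Proof. by rewrite shuffle_signE !big_set1. Qed.

Lemma shuffle_sign_set0 A : shuffle_sign R A set0 = 1.
Proof. by rewrite shuffle_signE big1 // => i _; rewrite big_set0. Qed.

(** The leading minus comes from moving dz_p past dzbar_l, always an inversion. dzbar_q and dz_k
    never form one. *)
Lemma shuffle_sign_pairset k l p q :
  shuffle_sign R (pairset k l) (pairset p q) = - (-1) ^+ (p < k)%N * (-1) ^+ (q < l)%N.
Proof.
rewrite shuffle_signE !big_pairset /= ltn_add2l [(3 + q < k)%N]ltnNge.
rewrite (leq_trans (ltnW (ltn_ord k)) (leq_addr _ _)) /=.
by rewrite (leq_trans (ltn_ord p) (leq_addr _ _)) /= mulr1 mulN1r mulNr mulrN.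
Qed.

(** In the complement, [k] indices lie below that of dz_k and [l + 2] below that of dzbar_l. *)
Lemma shuffle_sign_pairsetC k l :
  shuffle_sign R (pairset k l) (~: pairset k l) = (-1) ^+ k * (-1) ^+ l.
Proof.
rewrite shuffle_signE big_pairset !big_setC_pairset /=.
by move: k l; do 2 apply: ord3P; rewrite /= ?expr0 ?expr1; ring.
Qed.

Lemma sum_over_pairset (F : {set 'I_6} -> C) :
    (forall S, F S != 0 -> exists k l, S = pairset k l) ->
  \sum_S F S = \sum_(k < 3) \sum_(l < 3) F (pairset k l).
Proof.
move=> Fs; pose f (u : 'I_3 * 'I_3) := pairset u.1 u.2.
rewrite pair_big /= (bigID (mem (f @: setT))) /= [X in _ + X]big1 ?addr0.
  rewrite big_imset /=; last by move=> [? ?] [? ?] _ _ /pairset_inj[/= -> ->].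
  by apply: eq_bigl => u; rewrite inE.
move=> S /imsetP nS; apply/eqP/negPn/negP => /Fs[k [l SE]].
by apply: nS; exists (k, l).
Qed.

Lemma wedge_fone b S : wedge b (@fone R) S = b S.
Proof.
rewrite /wedge (bigD1 S) //= setDv /fone eqxx shuffle_sign_set0 mulr1 mul1r big1 ?addr0 //.
move=> A /andP[AS nAS]; rewrite ifN ?mulr0 // setD_eq0.
by apply: contra nAS => SA; rewrite eqEsubset AS.
Qed.

Lemma wedge_gen i b S :
  wedge (gen R i) b S = if i \in S then shuffle_sign R [set i] (S :\ i) * b (S :\ i) else 0.
Proof.
rewrite /wedge; case: ifP => iS; last first.
  rewrite big1 // => A AS; rewrite /gen ifN ?mulr0 ?mul0r //.
  by apply: contraFneq iS => E; apply: (subsetP AS); rewrite E set11.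
rewrite (bigD1 [set i]) ?sub1set //= /gen eqxx mulr1 big1 ?addr0 //.
by move=> A /andP[_ nA]; rewrite ifN ?mulr0 ?mul0r.
Qed.

Lemma wedge_pairset a b k l : is_pq 1 0 a ->
  wedge a b (pairset k l) = a [set lshift 3 k] * b [set rshift 3 l].
Proof.
move=> ha; have sub : [set lshift 3 k] \subset pairset k l by rewrite sub1set in_shift.
rewrite /wedge (bigD1 _ sub) /= big1 ?addr0.
  rewrite [pairset k l :\: _](_ : _ = [set rshift 3 l]).
    by rewrite shuffle_sign_set1 /= ltnNge (leq_trans (ltnW (ltn_ord k)) (leq_addr _ _)) mul1r.
  apply/setP; apply: ord6P => m; rewrite in_setD !in_shift; first by case: (m == k).
  by [].
move=> A /andP[AS nA]; case: (eqVneq (a A) 0) => [-> | /(is_pq10_set1 ha)[m AE]].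
  by rewrite mulr0 mul0r.
move: AS nA; rewrite AE sub1set in_shift => /eqP->.
by rewrite eqxx.
Qed.

Lemma fconj_set1 a T : is_pq 1 0 a ->
  fconj a T = \sum_(k < 3) (a [set lshift 3 k])^* * gen R (rshift 3 k) T.
Proof.
move=> ha; pose f k : {set 'I_6} := [set lshift 3 k].
rewrite /fconj (bigID (mem (f @: setT))) /= [X in _ + X]big1 ?addr0.
  rewrite big_imset /=; last first.
    by move=> k k' _ _ /set1l_inj.
  apply: eq_big => [k | k _]; first by rewrite inE.
  rewrite /f enum_set1 /= wedge_fone /swap6.
  by case: split_ordP => k' /eqP; rewrite ?eq_lshift ?eq_lrshift // => /eqP->.
move=> S /imsetP nS; case: (eqVneq (a S) 0) => [-> | /(is_pq10_set1 ha)[m SE]].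
  by rewrite rmorph0 mul0r.
by case: nS; exists m.
Qed.

Lemma is_pq_gen_lshift k : is_pq 1 0 (gen R (lshift 3 k)).
Proof.
move=> S; rewrite /gen; case: (S =P _) => [-> _ | _]; last by rewrite eqxx.
split.
  apply/eqP/cards1P; exists (lshift 3 k); apply/setP => i.
  by rewrite !inE; case: eqP => // ->; rewrite holo_lshift.
apply/eqP; rewrite cards_eq0; apply/eqP/setP => i.
by rewrite !inE; case: eqP => // ->; rewrite holo_lshift.
Qed.

Lemma is_pq_gen_rshift k : is_pq 0 1 (gen R (rshift 3 k)).
Proof.
move=> S; rewrite /gen; case: (S =P _) => [-> _ | _]; last by rewrite eqxx.
split; last first.
  apply/eqP/cards1P; exists (rshift 3 k); apply/setP => i.
  by rewrite !inE; case: eqP => // ->; rewrite holo_rshift.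
apply/eqP; rewrite cards_eq0; apply/eqP/setP => i.
by rewrite !inE; case: eqP => // ->; rewrite holo_rshift.
Qed.

Lemma is_pq_sum (p q : nat) (I : finType) (c : I -> C) (f : I -> cform R) :
  (forall i, is_pq p q (f i)) -> is_pq p q (fun S => \sum_i c i * f i S).
Proof.
move=> fpq S.
have [/existsP[i fi] _ | /existsPn f0] := boolP [exists i, f i S != 0]; first exact: fpq fi.
by rewrite big1 ?eqxx // => i _; rewrite (eqP (negbNE (f0 i))) mulr0.
Qed.

Lemma is_pq_fconj10 a : is_pq 1 0 a -> is_pq 0 1 (fconj a).
Proof.
move=> ha S; rewrite fconj_set1 //.
exact (is_pq_sum (c := fun k => (a [set lshift 3 k])^*) is_pq_gen_rshift (S := S)).
Qed.

Lemma fconj_rshift a l : is_pq 1 0 a -> fconj a [set rshift 3 l] = (a [set lshift 3 l])^*.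
Proof.
move=> ha; rewrite fconj_set1 // (bigD1 l) //= /gen eqxx mulr1 big1 ?addr0 // => k kl.
by rewrite ifN ?mulr0 //; rewrite (inj_eq set1r_inj) eq_sym.
Qed.

Lemma wedge_fconj_pairset a k l : is_pq 1 0 a ->
  wedge a (fconj a) (pairset k l) = a [set lshift 3 k] * (a [set lshift 3 l])^*.
Proof. by move=> ha; rewrite wedge_pairset // fconj_rshift. Qed.

Lemma is_pq_wedge_fconj a : is_pq 1 0 a -> is_pq 1 1 (wedge a (fconj a)).
Proof. by move=> ha; apply: (is_pq_wedge ha (is_pq_fconj10 ha)). Qed.

(** Conjugation sends dz_l /\ dzbar_k to dzbar_l /\ dz_k, and sorting the two factors costs the
    sign. *)
Lemma fconj_pairset a k l : is_pq 1 1 a -> fconj a (pairset k l) = - (a (pairset l k))^*.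
Proof.
move=> ha; rewrite /fconj sum_over_pairset; last first.
  move=> S; case: (eqVneq (a S) 0) => [-> | /(is_pq11_pairset ha)//].
  by rewrite rmorph0 mul0r eqxx.
have E p q : bigwedge [seq gen R (swap6 i) | i <- enum (pairset p q)] (pairset k l)
    = - ((p == l) && (q == k))%:R.
  rewrite enum_pairset /=.
  have -> : swap6 (lshift 3 p) = rshift 3 p.
    by rewrite /swap6; case: split_ordP => k' /eqP; rewrite ?eq_lshift ?eq_lrshift // => /eqP->.
  have -> : swap6 (rshift 3 q) = lshift 3 q.
    by rewrite /swap6; case: split_ordP => k' /eqP; rewrite ?eq_rshift ?eq_rlshift // => /eqP->.
  rewrite wedge_gen wedge_fone in_shift; case: eqP => [-> | _]; last by rewrite oppr0.
  have -> : pairset k l :\ rshift 3 l = [set lshift 3 k].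
    apply/setP; apply: ord6P => m; rewrite in_setD !in_shift //.
    by case: (m == l).
  rewrite shuffle_sign_set1 /= (leq_trans (ltn_ord k) (leq_addr _ _)) /= expr1 mulN1r /gen.
  by rewrite (inj_eq set1l_inj) eq_sym; case: (q == k).
rewrite (bigD1 l) //= (bigD1 k) //= E !eqxx mulrN1 big1 ?addr0.
  rewrite big1 ?addr0 // => p pl; rewrite big1 // => q _.
  by rewrite E (negbTE pl) oppr0 mulr0.
by move=> q qk; rewrite E (negbTE qk) andbF oppr0 mulr0.
Qed.

Lemma sum3_cyclic (F : 'I_3 -> C) k : \sum_(p < 3) F p = F k + F (k + 1) + F (k + 2).
Proof. by rewrite sum3E; move: k; apply: ord3P; rewrite !ord3_cyclic; ring. Qed.

(** Splitting the complement into two pairs leaves two choices for the holomorphic index and two for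
    the other. This produces the bracket of [mixed_disc]. *)
Lemma wedge_setC_pairset Y Z k l : is_pq 1 1 Y ->
  wedge Y Z (~: pairset k l) = - ((-1) ^+ k * (-1) ^+ l) *
    (Y (pairset (k + 1) (l + 1)) * Z (pairset (k + 2) (l + 2))
     - Y (pairset (k + 1) (l + 2)) * Z (pairset (k + 2) (l + 1))
     - Y (pairset (k + 2) (l + 1)) * Z (pairset (k + 1) (l + 2))
     + Y (pairset (k + 2) (l + 2)) * Z (pairset (k + 1) (l + 1))).
Proof.
move=> hY; rewrite /wedge big_mkcond sum_over_pairset /=; last first.
  move=> S; case: ifP => _; last by rewrite eqxx.
  case: (eqVneq (Y S) 0) => [-> | /(is_pq11_pairset hY)//].
  by rewrite mulr0 mul0r eqxx.
have sub p q : (pairset p q \subset ~: pairset k l) = (p != k) && (q != l).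
  by rewrite -disjoint_pairset disjoints_subset.
have term p q p' q' : uniq [:: k; p; p'] -> uniq [:: l; q; q'] ->
    shuffle_sign R (pairset p q) (~: pairset k l :\: pairset p q) * Y (pairset p q) *
      Z (~: pairset k l :\: pairset p q)
    = - (-1) ^+ (p' < p)%N * (-1) ^+ (q' < q)%N * Y (pairset p q) * Z (pairset p' q').
  by move=> U V; rewrite (setCD_pairset U V) shuffle_sign_pairset.
have U12 (m : 'I_3) : uniq [:: m; m + 1; m + 2] by move: m; apply: ord3P.
have U21 (m : 'I_3) : uniq [:: m; m + 2; m + 1] by move: m; apply: ord3P.
rewrite (sum3_cyclic _ k) !(sum3_cyclic _ l) !sub.
have n1 (m : 'I_3) : (m + 1 != m) && (m + 2 != m) by move: m; apply: ord3P.
have [/andP[k1 k2] /andP[l1 l2]] := (n1 k, n1 l).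
rewrite !eqxx k1 k2 l1 l2 /=.
rewrite (term _ _ _ _ (U12 k) (U12 l)) (term _ _ _ _ (U12 k) (U21 l)).
rewrite (term _ _ _ _ (U21 k) (U12 l)) (term _ _ _ _ (U21 k) (U21 l)).
(* Modulo 3, [m + 2] is smaller than [m + 1] only for [m = 1], the one odd index. *)
have s12 (m : 'I_3) : (-1) ^+ ((m + 2)%R < (m + 1)%R)%N = (-1) ^+ m :> C.
  by rewrite -[LHS]signr_odd -[RHS]signr_odd; move: m; apply: ord3P.
have s21 (m : 'I_3) : (-1) ^+ ((m + 1)%R < (m + 2)%R)%N = - (-1) ^+ m :> C.
  by rewrite -[RHS]mulN1r -exprS -[LHS]signr_odd -[RHS]signr_odd; move: m; apply: ord3P.
rewrite !s12 !s21; ring.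
Qed.

(** The sign (-1)^(k+l) of [shuffle_sign_pairsetC] cancels the one in [wedge_setC_pairset], so only
    a global minus remains. *)
Lemma wedge3_setT X Y Z : is_pq 1 1 X -> is_pq 1 1 Y ->
  wedge X (wedge Y Z) setT = - \sum_(k < 3) \sum_(l < 3) X (pairset k l) *
    (Y (pairset (k + 1) (l + 1)) * Z (pairset (k + 2) (l + 2))
     - Y (pairset (k + 1) (l + 2)) * Z (pairset (k + 2) (l + 1))
     - Y (pairset (k + 2) (l + 1)) * Z (pairset (k + 1) (l + 2))
     + Y (pairset (k + 2) (l + 2)) * Z (pairset (k + 1) (l + 1))).
Proof.
move=> hX hY; rewrite {1}/wedge big_mkcond sum_over_pairset /=; last first.
  move=> S; rewrite subsetT; case: (eqVneq (X S) 0) => [-> | /(is_pq11_pairset hX)//].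
  by rewrite mulr0 mul0r eqxx.
rewrite -sumrN; apply: eq_bigr => k _; rewrite -sumrN; apply: eq_bigr => l _.
rewrite subsetT setTD shuffle_sign_pairsetC wedge_setC_pairset //.
set W := (_ + _ : C); have sq (m : 'I_3) : ((-1) ^+ m) ^+ 2 = 1 :> C by rewrite sqrr_sign.
move: ((-1) ^+ k) ((-1) ^+ l) (sq k) (sq l) => s t hs ht.
by rewrite [LHS](_ : _ = - (s ^+ 2 * t ^+ 2 * (X (pairset k l) * W))); [rewrite hs ht !mul1r | ring].
Qed.

Lemma wedge_sub X Y Z S :
  wedge X (fadd Y (fopp Z)) S = wedge X Y S - wedge X Z S.
Proof.
rewrite /wedge -sumrB; apply: eq_bigr => A _.
by rewrite /fadd /fopp mulrBr.
Qed.

Lemma is_pq_fscale (p q : nat) c a : is_pq p q a -> is_pq p q (fscale c a).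
Proof. by move=> ha S; rewrite mulf_eq0 negb_or => /andP[_ /ha]. Qed.

Lemma gen_lshift_set1 k m : gen R (lshift 3 k) [set lshift 3 m] = (m == k)%:R.
Proof. by rewrite /gen (inj_eq set1l_inj); case: eqP. Qed.

Lemma gen_rshift_set1 k m : gen R (rshift 3 k) [set rshift 3 m] = (m == k)%:R.
Proof. by rewrite /gen (inj_eq set1r_inj); case: eqP. Qed.

Lemma is_pq_dw P l : is_pq 1 0 (@dw R P l).
Proof. exact (is_pq_sum (c := fun k => P l k) is_pq_gen_lshift). Qed.

Lemma dw_set1 P l k : @dw R P l [set lshift 3 k] = P l k.
Proof.
rewrite /dw (bigD1 k) //= [dz _ _ _]gen_lshift_set1 eqxx mulr1 big1 ?addr0 // => m mk.
by rewrite [dz _ _ _]gen_lshift_set1 eq_sym (negbTE mk) mulr0.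
Qed.

Lemma std_kahler_pairset P k l :
  @std_kahler R P (pairset k l) = 'i / 2%:R * \sum_(m < 3) P m k * (P m l)^*.
Proof.
rewrite mulr_sumr; apply: eq_bigr => m _.
by rewrite /fscale wedge_fconj_pairset ?dw_set1 //; apply: is_pq_dw.
Qed.

Lemma dz_dzb_pairset c m k l :
  fscale c (wedge (dz R m) (dzb R m)) (pairset k l) = c * ((k == m) && (l == m))%:R.
Proof.
rewrite /fscale wedge_pairset; last exact: is_pq_gen_lshift.
by rewrite [dz _ _ _]gen_lshift_set1 [dzb _ _ _]gen_rshift_set1 -natrM mulnb.
Qed.

(** The cube of i/2 is -i/8, and sorting the six factors is an odd permutation. *)
Lemma Vol_setT : Vol R setT = 'i / 8%:R.
Proof.
have pq m : is_pq 1 1 (fscale ('i / 2%:R) (wedge (dz R m) (dzb R m))).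
  exact (is_pq_fscale (is_pq_wedge (@is_pq_gen_lshift m) (@is_pq_gen_rshift m))).
have -> : Vol R = bigwedge [seq fscale ('i / 2%:R) (wedge (dz R l) (dzb R l)) | l <- [:: 0; 1; 2]].
  rewrite /Vol; congr (bigwedge (map _ _)).
  by apply: (inj_map val_inj); rewrite val_enum_ord.
rewrite /= wedge3_setT // !sum3E !ord3_cyclic !wedge_fone !dz_dzb_pairset /=.
rewrite !(mulr0, mul0r, mulr1, addr0, subr0, add0r).
have i2 := sqrCi C; rewrite (_ : 8%:R = 2%:R ^+ 3 :> C); last by rewrite -natrX.
have -> : - ('i / 2%:R * ('i / 2%:R * ('i / 2%:R))) = - ('i ^+ 2) * 'i / 2%:R ^+ 3 :> C.
  by field.
by rewrite i2 opprK mul1r.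
Qed.
End WedgeCoefficients.

(** * From matrices of forms to matrices of scalars *)

Section Griffiths.
Variable R : realType.
Local Notation C := (R[i]).
Implicit Types M : 'I_2 -> 'I_2 -> cform R.

(* The matrices A_ij of the header: [- 2 * 'i] is the inverse of ['i / 2]. *)
Definition coef_matrix M i j (k l : 'I_3) : C := - 2%:R * 'i * M i j (pairset k l).

Lemma form_coef_matrix M i j k l : M i j (pairset k l) = 'i / 2%:R * coef_matrix M i j k l.
Proof.
rewrite /coef_matrix; have i2 := sqrCi C.
rewrite [RHS](_ : _ = - ('i ^+ 2) * M i j (pairset k l)); first by rewrite i2 opprK mul1r.
by field.
Qed.

(** The minus in [fconj_pairset] is compensated by conjugating the imaginary factor of
    [coef_matrix]. *)
Lemma coef_matrix_herm M i j k l : griffiths_positive M ->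
  coef_matrix M i j k l = (coef_matrix M j i l k)^*.
Proof.
move=> [Mpq [Mh _]].
rewrite /coef_matrix Mh fconj_pairset // !rmorphM rmorphN /= conjCi conjC_nat.
ring.
Qed.

Lemma coef_matrix_gt0 M (theta : 'I_2 -> C) : griffiths_positive M -> (exists i, theta i != 0) ->
  forall v : 'I_3 -> C, (exists k, v k != 0) ->
  0 < \sum_(i < 2) \sum_(j < 2) theta i * sesq (coef_matrix M i j) v v * (theta j)^*.
Proof.
move=> [_ [_ Mpos]] theta0 v v0; have [_ [P [Pu PE]]] := Mpos theta theta0.
have E k l : \sum_(i < 2) \sum_(j < 2) theta i * coef_matrix M i j k l * (theta j)^*
    = \sum_(m < 3) P m k * (P m l)^*.
  have := congr1 (fun f => f (pairset k l)) PE; rewrite /= std_kahler_pairset.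
  under eq_bigr do under eq_bigr do rewrite form_coef_matrix mulrCA -mulrA.
  under eq_bigr do rewrite -mulr_sumr.
  (* The common factor i/2 of both sides is cancelled, which leaves the Gram matrix of [P]. *)
  rewrite -mulr_sumr => /mulfI; apply.
  by rewrite mulf_neq0 ?neq0Ci // invr_eq0 pnatr_eq0.
by rewrite sesq_sum (eq_sesq _ _ E); apply: sesq_gram_gt0.
Qed.

(** The constant: two factors i/2 and the minus of [wedge3_setT] give 1/4, and i/4 divided by the
    coefficient i/8 of [Vol] is 2. *)
Lemma Qform_mixed_disc M a (x := fun k => a [set lshift 3 k]) :
  griffiths_positive M -> is_pq 1 0 a ->
  Qform (det2 M) a a = 2%:R * (mixed_disc (coef_matrix M 0 0) (coef_matrix M 1 1) x
                               - mixed_disc (coef_matrix M 0 1) (coef_matrix M 1 0) x).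
Proof.
move=> [Mpq _] ha.
have E i j i' j' : wedge (wedge a (fconj a)) (wedge (M i j) (M i' j')) setT
    = 4%:R^-1 * mixed_disc (coef_matrix M i j) (coef_matrix M i' j') x.
  rewrite wedge3_setT //; last exact: is_pq_wedge_fconj.
  rewrite /mixed_disc mulr_sumr -sumrN; apply: eq_bigr => k _.
  rewrite mulr_sumr -sumrN; apply: eq_bigr => l _.
  rewrite wedge_fconj_pairset // !form_coef_matrix -/(x k) -/(x l).
  set Z := (X in _ = _ * (_ * X)).
  have i2 := sqrCi C.
  rewrite [LHS](_ : _ = - 'i ^+ 2 * (4%:R^-1 * (x k * (x l)^* * Z))).
    by rewrite i2 opprK mul1r.
  by rewrite /Z; field.
rewrite /Qform /star /det2 wedge_sub !E Vol_setT -mulrBr.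
by field; rewrite neq0Ci.
Qed.
End Griffiths.

Theorem mainTheorem7 (R : realType) (M : 'I_2 -> 'I_2 -> cform R) :
  griffiths_positive M ->
  forall a : cform R, is_pq 1 0 a -> a <> fzero R ->
    0 < Qform (det2 M) a a.
Proof.
move=> hM a ha a0; rewrite Qform_mixed_disc // mulr_gt0 ?ltr0n //.
apply: griffiths_mixed_disc_gt0.
- by move=> i j k l; apply: coef_matrix_herm.
- by move=> theta theta0; apply: coef_matrix_gt0.
(* A (1,0)-form whose three coefficients vanish is zero on every index set. *)
apply/existsP; apply: contraT; rewrite negb_exists => /forallP z.
case: a0; apply: funext => S; apply/eqP; apply: contraT => aS.
have [k SE] := is_pq10_set1 ha aS.
by move: (z k) aS; rewrite SE => /negbNE ->.
Qed.
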